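(* Let $(X,R,B)$ and $(X',R',B')$ be two finite presentations with base points of a group $G$ that are strongly Tietze equivalent preserving base points. Then $\Gamma(X,R,B)\sim\Gamma(X',R',B')$, i.e. the associated group-weighted graphs are connected by a finite sequence of elementary transformations of group-weighted graphs.
   Context: **Free differential.** Let $F_n$ be the free group on $x_1,\dots,x_n$. The free differentials $\frac{\partial}{\partial x_i}:\mathbb{Z}F_n\to\mathbb{Z}F_n$ are the additive homomorphisms with $\frac{\partial}{\partial x_i}(pq)=\frac{\partial p}{\partial x_i}+p\frac{\partial q}{\partial x_i}$ for $p,q\in F_n$ and $\frac{\partial x_j}{\partial x_i}=\delta_{ij}$. **Presentations with base points.** Let $\langle X|R\rangle=\langle x_1,\dots,x_n|r_1,\dots,r_m\rangle$ be a finite presentation of a group $G$, and let $\mathrm{pr}:F_n\to G$ be the projection, extended to $\mathbb{Z}F_n\to\mathbb{Z}G$. A base point of a relation $r$ is a chosen occurrence of one of the generators in the word $r$. The notation $(X,R,B)$ means a presentation together with a base point of each relation such that (standing assumption): the generators occurring at the base points of distinct relations are distinct (so $r\mapsto$ its base generator is an injection $R\to X$); and if $x_i$ is the base generator of $r_i$ then $\mathrm{pr}(\partial r_i/\partial x_i)\neq0$ in $\mathbb{Z}G$. Label so that the base generator of $r_i$ is $x_i$. Up to inversion and conjugation (cyclic rotation) one writes $r_i=x_if_i^{-1}$, where the displayed $x_i$ is the base occurrence and $f_i$ is a word in $x_1,\dots,x_n$; the relation then reads $x_i=f_i$. **Group-weighted graph.** $\Gamma(X,R,B)$ is the directed graph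 with vertices $v_1,\dots,v_n$ and, for each $1\le i\le m$ and $1\le j\le n$, an edge from $v_i$ to $v_j$ of weight $\mathrm{pr}(\partial f_i/\partial x_j)\in\mathbb{Z}G$ (vertices of generators that are not base generators have no outgoing edges). **Elementary transformations of a group-weighted graph** (the following and their inverses): - (G1) (null edge) Add or delete an edge of weight $0$ from one vertex to another, where the origin of that edge is not a sink. - (G2) (summing weights) Replace parallel edges from $O_1$ to $O_2$ with weights $w_1,\dots,w_n$ by a single edge of weight $\sum_iw_i$. - (G3) (source eliminating) Delete a vertex $y$ having no incoming edges, together with its outgoing edges to $v_{i_1},\dots,v_{i_m}$ of weights $w_{i_1},\dots,w_{i_m}$, provided there exists a word $f$ in the generators with $df=\sum_jw_{i_j}dx_{i_j}$, meaning that the images in $\mathbb{Z}G$ of the free derivatives of $f$ with respect to $x_{i_j}$ are the $w_{i_j}$, and all other derivatives map to $0$. - (G4) (hub vertex resolution) Let $v_1\neq v_2$, let $e$ be an edge from $v_1$ to $v_2$ of weight $u$, and let $f_1,\dots,f_n$ ($n\ge1$) be all edges starting at $v_2$, with weights $w_1,\dots,w_n$. Delete $e$ and add, for each $i$, an edge from $v_1$ to the terminal vertex of $f_i$ of weight $uw_i$; keep all other edges. We write $\Gamma\sim\Gamma'$ if $\Gamma$ and $\Gamma'$ are connected by a finite sequence of such transformations. **Strong Tietze equivalence preserving base points.** Consider the following operations and their inverses: (1) replace a relation $r_i$ by $r_i^{-1}$; (2) replace $r_i$ by a conjugate $wr_iw^{-1}$, $w\in F_n$; (3) replace $r_i$ by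 $r_ir_k$ with $k\ne i$; (4) add a new generator $x$ and a new relation $xw^{-1}$, where $w\in F_n$ is any word in $x_1,\dots,x_n$. Under (1), (2), (3) the base points are unchanged; under (4) the base point of the new relation $xw^{-1}$ is $x$. Two presentations with base points are strongly Tietze equivalent preserving base points if they are connected by a finite sequence of these operations and their inverses. The groups presented are identified along these operations. *)

(* Defs.v *)
From HB Require Import structures.
From Stdlib Require Import Relation_Operators.
From mathcomp Require Import all_boot all_algebra.
From mathcomp Require Import finmap monalg.

Set Implicit Arguments.
Unset Strict Implicit.
Unset Printing Implicit Defensive.

Import GRing.Theory.
Local Open Scope ring_scope.

(* The integral group ring ZG.  The library's ring structure on {malg R[K]}  *)
(* is restricted to monoids K without nontrivial units, so for a group the   *)
(* product is built here on top of the additive group {malg int[G]}.         *)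

Definition gring (G : groupType) : Type := {malg int[G]}.

HB.instance Definition _ (G : groupType) :=
  GRing.Zmodule.copy (gring G) {malg int[G]}.

(* Locked: conversion otherwise unfolds these when comparing elements of ZG. *)
HB.lock Definition gelt (G : groupType) (g : G) : gring G := mkmalgU g 1.

(* The additive map ZG -> A with value f g at g. *)
HB.lock Definition glin (G : groupType) (A : zmodType) (f : G -> A)
    (p : gring G) : A :=
  \sum_(g <- msupp p) f g *~ mcoeff g p.

Section GroupRing.
Context {G : groupType}.

Lemma glinE (A : zmodType) (f : G -> A) (p : gring G) :
  glin f p = \sum_(g <- msupp p) f g *~ mcoeff g p.
Proof. by rewrite glin.unlock. Qed.

Lemma glinEw (A : zmodType) (f : G -> A) (p : gring G) (d : {fset G}) :
  (msupp p `<=` d)%fset -> glin f p = \sum_(g <- d) f g *~ mcoeff g p.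
Proof.
move=> le_pd; rewrite glinE; apply: big_fset_incl => // g _ gp.
by rewrite mcoeff_outdom // mulr0z.
Qed.

Fact glin_is_additive (A : zmodType) (f : G -> A) : zmod_morphism (glin f).
Proof.
move=> p q; pose d := (msupp p `|` msupp q)%fset.
rewrite (@glinEw _ _ (p - q) d) ?msuppB_le //.
rewrite (@glinEw _ _ p d) ?fsubsetUl // (@glinEw _ _ q d) ?fsubsetUr //.
by rewrite -sumrB; apply: eq_bigr => g _; rewrite mcoeffB mulrzBr.
Qed.

HB.instance Definition _ (A : zmodType) (f : G -> A) :=
  GRing.isZmodMorphism.Build (gring G) A (glin f) (glin_is_additive f).

Lemma glin_gelt (A : zmodType) (f : G -> A) g : glin f (gelt g) = f g.
Proof.
by rewrite glinE gelt.unlock msuppU oner_eq0 big_seq_fset1 mcoeffUU mulr1z.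
Qed.

Lemma gringE (p : gring G) : p = \sum_(g <- msupp p) gelt g *~ mcoeff g p.
Proof.
rewrite [LHS]monalgE; apply: eq_bigr => g _.
by rewrite gelt.unlock -(raddfMz (mkmalgU g)) intz.
Qed.

Lemma gring_ext (A : zmodType) (f h : {additive gring G -> A}) :
  (forall g, f (gelt g) = h (gelt g)) -> f =1 h.
Proof.
move=> fh p; rewrite [p]gringE !raddf_sum; apply: eq_bigr => g _.
by rewrite !raddfMz fh.
Qed.

Definition gmul (p q : gring G) : gring G :=
  glin (fun g => glin (fun h => gelt (g * h)%g) q) p.

Lemma gmul_gelt g h : gmul (gelt g) (gelt h) = gelt (g * h)%g.
Proof. by rewrite /gmul !glin_gelt. Qed.

Let gmulr (q p : gring G) := gmul p q.

Fact gmulBl (r p q : gring G) : gmulr r (p - q) = gmulr r p - gmulr r q.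
Proof. exact: raddfB. Qed.

HB.instance Definition _ q := GRing.isZmodMorphism.Build (gring G) (gring G)
  (gmulr q) (gmulBl q).

Fact gmulBr (r p q : gring G) : gmul r (p - q) = gmul r p - gmul r q.
Proof.
rewrite /gmul !(glinE _ r) -sumrB; apply: eq_bigr => g _.
by rewrite raddfB mulrzBl.
Qed.

HB.instance Definition _ p := GRing.isZmodMorphism.Build (gring G) (gring G)
  (gmul p) (gmulBr p).

Fact gmulA : associative gmul.
Proof.
move=> p q r.
apply: (gring_ext (f := gmulr (gmul q r)) (h := gmulr r \o gmulr q)) => g /=.
apply: (gring_ext (f := gmul (gelt g) \o gmulr r)
  (h := gmulr r \o gmul (gelt g))) => h /=.
apply: (gring_ext (f := gmul (gelt g) \o gmul (gelt h))
  (h := gmul (gmul (gelt g) (gelt h)))) => k /=.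
by rewrite /gmulr !gmul_gelt mulgA.
Qed.

Fact gmul1l : left_id (gelt 1%g) gmul.
Proof.
by move=> p; apply: (gring_ext (f := gmul (gelt 1%g)) (h := idfun)) => g /=;
  rewrite ?/gmulr gmul_gelt mul1g.
Qed.

Fact gmul1r : right_id (gelt 1%g) gmul.
Proof.
by move=> p; apply: (gring_ext (f := gmulr (gelt 1%g)) (h := idfun)) => g /=;
  rewrite ?/gmulr gmul_gelt mulg1.
Qed.

Fact gmulDl : left_distributive gmul +%R.
Proof. by move=> p q r; exact: (raddfD (gmulr r)). Qed.

Fact gmulDr : right_distributive gmul +%R.
Proof. by move=> p q r; exact: raddfD. Qed.

Fact gelt1_neq0 : gelt (1%g : G) != 0.
Proof. by rewrite gelt.unlock monalgU_eq0 oner_eq0. Qed.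

End GroupRing.

HB.instance Definition _ (G : groupType) := GRing.Zmodule_isNzRing.Build
  (gring G) gmulA gmul1l gmul1r gmulDl gmulDr gelt1_neq0.

Lemma gelt1 (G : groupType) : gelt (1%g : G) = 1.
Proof. by []. Qed.

Lemma geltM (G : groupType) (g h : G) : gelt (g * h)%g = gelt g * gelt h.
Proof. by rewrite -gmul_gelt. Qed.

(* Words in the letters x (encoded (x, true)) and x^-1 (encoded (x, false)). *)

Definition word (X : Type) : Type := seq (X * bool).

Definition linv (X : Type) (a : X * bool) : X * bool := (a.1, ~~ a.2).

Definition winv (X : Type) (w : word X) : word X := rev (map (@linv X) w).

Definition wmap (X Y : Type) (f : X -> Y) (w : word X) : word Y :=
  [seq (f a.1, a.2) | a <- w].

(* The free group on X, realized as the set of freely reduced words. *)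

Section FreeGroup.
Context (X : choiceType).
Implicit Types (a b : X * bool) (u v w : word X).

Definition reduced w : bool := sorted (fun a b => b != linv a) w.

Definition push a w : word X :=
  if w is b :: s then if b == linv a then s else a :: w else [:: a].

Definition reduce w : word X := foldr push [::] w.

Lemma linvK : involutive (@linv X).
Proof. by case=> x b; rewrite /linv /= negbK. Qed.

Lemma push_reduced a w : reduced w -> reduced (push a w).
Proof.
case: w => [|b s] //= rw; case: eqP => [_|/eqP nab]; first exact: path_sorted rw.
by rewrite /= nab.
Qed.

Lemma foldr_push_reduced u w : reduced w -> reduced (foldr push w u).
Proof. by move=> rw; elim: u => //= a u; apply: push_reduced. Qed.

Lemma reduce_reduced w : reduced (reduce w).
Proof. exact: foldr_push_reduced. Qed.

Lemma pushK a w : reduced w -> push (linv a) (push a w) = w.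
Proof.
case: w => [|b s] /= rw; first by rewrite linvK eqxx.
case: eqP => [eb|_] /=; last by rewrite linvK eqxx.
by case: s rw => [|c s] /=; rewrite eb // => /andP[/negPf->].
Qed.

Lemma reduced_id w : reduced w -> reduce w = w.
Proof.
elim: w => //= a [|b s] IH // /andP[nab rs].
by change (push a (reduce (b :: s)) = a :: b :: s); rewrite IH //= (negPf nab).
Qed.

Lemma foldr_push_push a u w : reduced w ->
  foldr push w (push a u) = push a (foldr push w u).
Proof.
move=> rw; case: u => [|b s] //=; case: eqP => [->|_] //=.
by rewrite -{1}(linvK a) pushK // foldr_push_reduced.
Qed.

Lemma foldr_push_reduce u w : reduced w ->
  foldr push w (reduce u) = foldr push w u.
Proof. by move=> rw; elim: u => //= a u IH; rewrite foldr_push_push ?IH. Qed.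

Lemma reduce_cat u v : reduce (u ++ v) = foldr push (reduce v) u.
Proof. exact: foldr_cat. Qed.

Lemma reduce_catl u v : reduce (reduce u ++ v) = reduce (u ++ v).
Proof. by rewrite !reduce_cat foldr_push_reduce // foldr_push_reduced. Qed.

Lemma reduce_catr u v : reduce (u ++ reduce v) = reduce (u ++ v).
Proof. by rewrite !reduce_cat [reduce (reduce v)]reduced_id // foldr_push_reduced. Qed.

Lemma reduce_winvl w : reduce (winv w ++ w) = [::].
Proof.
elim: w => // a w IH; rewrite /winv map_cons rev_cons cat_rcons reduce_cat /=.
by rewrite pushK ?foldr_push_reduced // -reduce_cat.
Qed.

Lemma winvK : involutive (@winv X).
Proof.
by move=> w; rewrite /winv map_rev revK -map_comp map_id_in // => a _; rewrite /= linvK.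
Qed.

Lemma reduce_winvr w : reduce (w ++ winv w) = [::].
Proof. by rewrite -{1}(winvK w) reduce_winvl. Qed.

Definition freegrp : Type := {w : word X | reduced w}.

HB.instance Definition _ := Choice.copy freegrp {w : word X | reduced w}.

Definition fgw (w : word X) : freegrp := Sub (reduce w) (reduce_reduced w).

Definition fg1 : freegrp := fgw [::].
Definition fgmul (p q : freegrp) : freegrp := fgw (val p ++ val q).
Definition fginv (p : freegrp) : freegrp := fgw (winv (val p)).

Lemma val_fgw w : val (fgw w) = reduce w. Proof. by []. Qed.

Lemma valK_fgw (p : freegrp) : fgw (val p) = p.
Proof. by apply: val_inj; rewrite /= reduced_id ?(valP p). Qed.

Fact fgmulA : associative fgmul.
Proof.
by move=> p q r; apply: val_inj; rewrite !val_fgw reduce_catl reduce_catr catA.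
Qed.

Fact fgmul1l : left_id fg1 fgmul.
Proof. exact: valK_fgw. Qed.

Fact fgmul1r : right_id fg1 fgmul.
Proof. by move=> p; rewrite /fgmul /= cats0 valK_fgw. Qed.

Fact fgmulVl : left_inverse fg1 fginv fgmul.
Proof.
by move=> p; apply: val_inj; rewrite !val_fgw reduce_catl reduce_winvl.
Qed.

Fact fgmulVr : right_inverse fg1 fginv fgmul.
Proof.
by move=> p; apply: val_inj; rewrite !val_fgw reduce_catr reduce_winvr.
Qed.

HB.instance Definition _ := isGroup.Build freegrp
  fgmulA fgmul1l fgmul1r fgmulVl fgmulVr.

Lemma fgw_cat u v : fgw (u ++ v) = (fgw u * fgw v)%g.
Proof. by apply: val_inj; rewrite !val_fgw reduce_catl reduce_catr. Qed.

Lemma fgw_winv w : fgw (winv w) = ((fgw w)^-1)%g.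
Proof.
have e : (fgw (winv w) * fgw w = 1)%g.
  by rewrite -fgw_cat; apply: val_inj; rewrite /= reduce_winvl.
by rewrite -[LHS]mulg1 -(mulgV (fgw w)) mulgA e mul1g.
Qed.

Definition fggen (x : X) : freegrp := fgw [:: (x, true)].

End FreeGroup.

(* The free differential d/dx : ZF -> ZF. *)

Section FreeDifferential.
Context {X : choiceType} (x : X).
Implicit Types (w : word X).

Definition foxl (a : X * bool) : gring (freegrp X) :=
  if a.1 == x then (if a.2 then 1 else - gelt (fgw [:: a])) else 0.

Fixpoint foxw w : gring (freegrp X) :=
  if w is a :: s then foxl a + gelt (fgw [:: a]) * foxw s else 0.

Definition fox (p : gring (freegrp X)) : gring (freegrp X) :=
  glin (fun u : freegrp X => foxw (val u)) p.

HB.instance Definition _ := GRing.Additive.copy fox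
  (glin (fun u : freegrp X => foxw (val u))).

Lemma foxl_inv a : foxl a + gelt (fgw [:: a]) * foxl (linv a) = 0.
Proof.
rewrite /foxl /=; case: eqP => _; last by rewrite mulr0 addr0.
have e : fgw [:: a; linv a] = 1%g :> freegrp X by apply: val_inj; rewrite /= eqxx.
case: a e => y [] /= e; last by rewrite mulr1 addNr.
by rewrite mulrN -geltM -fgw_cat e gelt1 subrr.
Qed.

Lemma foxw_push a w : foxw (push a w) = foxl a + gelt (fgw [:: a]) * foxw w.
Proof.
case: w => [|b s] //=; case: eqP => [->|_] //=.
rewrite mulrDr addrA foxl_inv add0r mulrA -geltM -fgw_cat.
have -> : fgw ([:: a] ++ [:: linv a]) = 1%g :> freegrp X.
  by apply: val_inj; rewrite /= eqxx.
by rewrite gelt1 mul1r.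
Qed.

Lemma foxw_reduce w : foxw (reduce w) = foxw w.
Proof. by elim: w => //= a w IH; rewrite foxw_push IH. Qed.

Lemma foxw_cat u w : foxw (u ++ w) = foxw u + gelt (fgw u) * foxw w.
Proof.
elim: u => [|a u IH] /=.
  by rewrite [gelt _](_ : _ = 1) ?mul1r ?add0r.
have -> : fgw (a :: u) = (fgw [:: a] * fgw u)%g by rewrite -fgw_cat.
by rewrite geltM IH mulrDr addrA mulrA.
Qed.

Lemma fox_gelt w : fox (gelt (fgw w)) = foxw w.
Proof. by rewrite [LHS]glin_gelt /= foxw_reduce. Qed.

Lemma foxM (p q : freegrp X) :
  fox (gelt (p * q)%g) = fox (gelt p) + gelt p * fox (gelt q).
Proof.
by rewrite -[p]valK_fgw -[q]valK_fgw -fgw_cat !fox_gelt foxw_cat.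
Qed.

Lemma fox_gen (y : X) : fox (gelt (fggen y)) = (y == x)%:R.
Proof. by rewrite fox_gelt /= mulr0 addr0 /foxl; case: eqP. Qed.

End FreeDifferential.

(* The homomorphism F -> G with x |-> m x, and its extension ZF -> ZG. *)

Section Projection.
Context {X : choiceType} {G : groupType} (m : X -> G).

Definition evalw (w : word X) : G :=
  foldr (fun a g => (if a.2 then m a.1 else (m a.1)^-1) * g)%g 1%g w.

Definition prF (u : freegrp X) : G := evalw (val u).

Definition prZ (p : gring (freegrp X)) : gring G :=
  glin (fun u : freegrp X => gelt (prF u)) p.

HB.instance Definition _ := GRing.Additive.copy prZ
  (glin (fun u : freegrp X => gelt (prF u))).

Lemma evalw_push a w : evalw (push a w) = evalw (a :: w).
Proof.
case: w => [|b s] //=; case: eqP => [->|_] //=.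
by case: a => y [] /=; rewrite mulgA ?mulgV ?mulVg mul1g.
Qed.

Lemma evalw_cat u w : evalw (u ++ w) = (evalw u * evalw w)%g.
Proof. by elim: u => [|a u IH] /=; rewrite ?mul1g // IH mulgA. Qed.

Lemma prF_fgw w : prF (fgw w) = evalw w.
Proof. by rewrite /prF /=; elim: w => //= a w <-; rewrite evalw_push. Qed.

Lemma prFM (u v : freegrp X) : prF (u * v)%g = (prF u * prF v)%g.
Proof. by rewrite -[u]valK_fgw -[v]valK_fgw -fgw_cat !prF_fgw evalw_cat. Qed.

End Projection.

Inductive normal_closure (G : groupType) (S : G -> Prop) : G -> Prop :=
| ncl_in g : S g -> normal_closure S g
| ncl_1 : normal_closure S 1%g
| ncl_M g h :
    normal_closure S g -> normal_closure S h -> normal_closure S (g * h)%g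
| ncl_V g : normal_closure S g -> normal_closure S (g^-1)%g
| ncl_J g h : normal_closure S g -> normal_closure S (h * g * h^-1)%g.

(* A word with a base point: the word is bpre ++ (bgen, bsgn) :: bpost, and  *)
(* the middle letter is the chosen occurrence of the generator bgen.         *)

Record bword (X : Type) : Type := BWord {
  bpre : word X;
  bgen : X;
  bsgn : bool;
  bpost : word X
}.

Section BasedWords.
Context {X : choiceType}.
Implicit Types (r s : bword X) (w : word X).

Definition bw_word r : word X := bpre r ++ (bgen r, bsgn r) :: bpost r.

Definition bw_inv r : bword X :=
  BWord (winv (bpost r)) (bgen r) (~~ bsgn r) (winv (bpre r)).

Definition bw_conj w r : bword X :=
  BWord (w ++ bpre r) (bgen r) (bsgn r) (bpost r ++ winv w).

Definition bw_mul r s : bword X :=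
  BWord (bpre r) (bgen r) (bsgn r) (bpost r ++ bw_word s).

Definition bw_map (Y : Type) (f : X -> Y) r : bword Y :=
  BWord (wmap f (bpre r)) (f (bgen r)) (bsgn r) (wmap f (bpost r)).

(* Equality up to free reductions that do not touch the base occurrence. *)
Definition bw_feq r s : Prop :=
  [/\ fgw (bpre r) = fgw (bpre s), bgen r = bgen s, bsgn r = bsgn s
    & fgw (bpost r) = fgw (bpost s)].

(* The word f such that r, up to inversion and cyclic rotation, is x f^-1    *)
(* with x the base occurrence.  If r = u x v then x v u = x f^-1 for         *)
(* f = (v u)^-1; if r = u x^-1 v then r^-1 rotates to x u^-1 v^-1, so that   *)
(* f = v u.                                                                  *)
Definition bw_solve r : word X :=
  let vu := bpost r ++ bpre r in if bsgn r then winv vu else vu.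

Lemma bw_solveP r : exists c : freegrp X,
  (if bsgn r then fgw (bw_word r) else (fgw (bw_word r))^-1)%g =
  (c * (fggen (bgen r) * (fgw (bw_solve r))^-1) * c^-1)%g.
Proof.
case: r => u x [] v; rewrite /bw_word /bw_solve /=.
  exists (fgw u); rewrite fgw_winv invgK -[_ :: v]cat1s !fgw_cat -!mulgA.
  by rewrite mulgV mulg1.
exists ((fgw v)^-1)%g; rewrite -[_ :: v]cat1s !fgw_cat !invgM invgK -!mulgA.
by rewrite mulVg mulg1 [in RHS](_ : fggen x = (fgw [:: (x, false)])^-1)%g.
Qed.

End BasedWords.

(* Finite presentations of G with base points: the relators are indexed by   *)
(* the finite type rels, and mark is the restriction of pr : F -> G to the   *)
(* generators.                                                               *)

Record bpdata (G : groupType) : Type := BPData {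
  gens : finType;
  rels : finType;
  mark : gens -> G;
  relator : rels -> bword gens
}.

Definition presents (G : groupType) (P : bpdata G) : Prop :=
  (forall g : G, exists u : freegrp (gens P), prF (@mark G P) u = g) /\
  (forall u : freegrp (gens P), prF (@mark G P) u = 1%g <->
     normal_closure (fun v => exists r, v = fgw (bw_word (@relator G P r))) u).

Record bpres (G : groupType) : Type := BPres {
  bpd :> bpdata G;
  bp_presents : presents bpd;
  bp_inj : injective (fun r : rels bpd => bgen (relator r));
  bp_neq0 : forall r : rels bpd,
    prZ (@mark G bpd) (fox (bgen (relator r)) (gelt (fgw (bw_word (relator r)))))
      != 0
}.

Definition set_relator (G : groupType) (P : bpdata G) (i : rels P)
    (r : bword (gens P)) : bpdata G :=
  BPData (@mark G P) (fun j => if j == i then r else relator j).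

(* The new generator and the new relation x w^-1 are both indexed by None. *)
Definition add_generator (G : groupType) (P : bpdata G) (w : word (gens P)) :
    bpdata G :=
  @BPData G (option (gens P)) (option (rels P))
    (fun x => if x is Some y then mark y else evalw (@mark G P) w)
    (fun r => if r is Some s then bw_map some (relator s)
              else BWord [::] None true (wmap some (winv w))).

(* tietze_relabel and tietze_free express that a presentation is considered  *)
(* up to renaming its generators and relations, and that a word stands for   *)
(* an element of the free group.                                             *)
Inductive tietze_step (G : groupType) : bpdata G -> bpdata G -> Prop :=
| tietze_relabel (P Q : bpdata G) (f : gens P -> gens Q) (h : rels P -> rels Q) :
    bijective f -> bijective h ->
    (forall x, mark (f x) = mark x) ->
    (forall r, relator (h r) = bw_map f (relator r)) ->
    tietze_step P Q
| tietze_free (P : bpdata G) (i : rels P) (r : bword (gens P)) :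
    bw_feq (relator i) r -> tietze_step P (set_relator i r)
| tietze_inv (P : bpdata G) (i : rels P) :
    tietze_step P (set_relator i (bw_inv (relator i)))
| tietze_conj (P : bpdata G) (i : rels P) (w : word (gens P)) :
    tietze_step P (set_relator i (bw_conj w (relator i)))
| tietze_mul (P : bpdata G) (i k : rels P) :
    k != i -> tietze_step P (set_relator i (bw_mul (relator i) (relator k)))
| tietze_gen (P : bpdata G) (w : word (gens P)) :
    tietze_step P (add_generator w).

Definition strong_tietze (G : groupType) (P Q : bpres G) : Prop :=
  clos_refl_sym_trans (bpres G) (fun P Q => tietze_step P Q) P Q.

(* Group-weighted directed multigraphs.  Vertices stand for generators, and  *)
(* lab v is the image in G of the generator v; it is needed to speak of the  *)
(* images in ZG of free derivatives of words in the generators.              *)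

Definition wedge (V : Type) (G : groupType) : Type := (V * V * gring G)%type.

Definition org (V : Type) (G : groupType) (e : wedge V G) : V := e.1.1.
Definition tgt (V : Type) (G : groupType) (e : wedge V G) : V := e.1.2.
Definition wgt (V : Type) (G : groupType) (e : wedge V G) : gring G := e.2.

Record wgraph (G : groupType) : Type := WGraph {
  vert : finType;
  lab : vert -> G;
  edges : seq (wedge vert G)
}.

Definition emap (V W : Type) (G : groupType) (f : V -> W) (e : wedge V G) :
  wedge W G := (f (org e), f (tgt e), wgt e).

(* graph_iso: graphs are considered up to isomorphism, and edges form an     *)
(* unordered family.                                                         *)
(* graph_null: the origin is required not to be a sink in the graph without  *)
(* the null edge, which is the condition that is meaningful for adding as    *)
(* well as for deleting.  Null loops are allowed.                            *)
(* graph_source: in the larger graph the vertex None is a source, its        *)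
(* outgoing edges are listed by ws, and it stands for the generator None = f.*)
Inductive graph_step (G : groupType) : wgraph G -> wgraph G -> Prop :=
| graph_iso (A B : wgraph G) (f : vert A -> vert B) :
    bijective f -> (forall v, lab (f v) = lab v) ->
    perm_eq [seq emap f e | e <- edges A] (edges B) ->
    graph_step A B
| graph_null (V : finType) (l : V -> G) (E : seq (wedge V G)) (o t : V) :
    has (fun e => org e == o) E ->
    graph_step (WGraph l E) (WGraph l ((o, t, 0) :: E))
| graph_sum (V : finType) (l : V -> G) (E : seq (wedge V G)) (o t : V)
    (ws : seq (gring G)) :
    ws != [::] ->
    graph_step (WGraph l ([seq (o, t, w) | w <- ws] ++ E))
               (WGraph l ((o, t, \sum_(w <- ws) w) :: E))
| graph_source (V : finType) (l : V -> G) (E : seq (wedge V G))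
    (ws : seq (V * gring G)) (f : word V) :
    (forall v, prZ l (fox v (gelt (fgw f))) = \sum_(a <- ws | a.1 == v) a.2) ->
    graph_step
      (@WGraph G (option V) (fun x => if x is Some v then l v else evalw l f)
         ([seq (None, Some a.1, a.2) | a <- ws] ++ [seq emap some e | e <- E]))
      (WGraph l E)
| graph_hub (V : finType) (l : V -> G) (E : seq (wedge V G)) (v1 v2 : V)
    (u : gring G) :
    v1 != v2 -> has (fun e => org e == v2) E ->
    graph_step (WGraph l ((v1, v2, u) :: E))
      (WGraph l ([seq (v1, tgt e, u * wgt e) | e <- E & org e == v2] ++ E)).

Definition graph_equiv (G : groupType) : wgraph G -> wgraph G -> Prop :=
  clos_refl_sym_trans (wgraph G) (@graph_step G).

Definition pgraph (G : groupType) (P : bpres G) : wgraph G :=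
  WGraph (@mark G P)
    [seq (bgen (relator r), x,
          prZ (@mark G P) (fox x (gelt (fgw (bw_solve (relator r))))))
    | r <- enum (rels P), x <- enum (gens P)].

(* Main.v *)
Require Import Defs.
From Stdlib Require Import Relation_Operators.
From mathcomp Require Import all_boot all_algebra.

Set Implicit Arguments.
Unset Strict Implicit.
Unset Printing Implicit Defensive.

Import GRing.Theory.
Local Open Scope ring_scope.

(** Adding null edges and summing parallel edges never change two pieces of data
of a weighted graph: which vertices have outgoing edges, and, for each ordered
pair of vertices, the sum of the weights of the edges from the first to the
second.  Conversely these data determine the graph up to those two moves
([graph_equiv_total], and [graph_equiv_bij] when the vertices are renamed): null
edges can be added from every non-sink to every vertex, after which all other
edges can be absorbed into them.  So graphs can be compared through sums of
weights alone, and only source eliminations and hub resolutions have to be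
performed explicitly.

It suffices to treat one Tietze operation.  Inverting or conjugating a relator
does not change the element f of the free group for which the relation reads
x = f, so the graph is the same.

Replacing r_i by r_i r_k inserts r_k or its inverse into f_i.  Over ZG, where
r_k = 1, this changes df_i by a multiple of dr_k, and dr_k is in turn a multiple
of dx_k - df_k, because r_k is conjugate to x_k f_k^-1 or to its inverse.  Hence
there is g in ZG with df_i' = df_i + g df_k - g dx_k ([slope_mul]).  On the
graph this is one hub resolution: split the edges from v_i to v_k so that one of
them has weight g and another one -g, and resolve the one of weight g at v_k
([graph_equiv_mul]).

A new generator x = w is a vertex v_x all of whose incoming edges are null, with
outgoing weights dw.  One would delete the null edges and then eliminate the
source v_x.  If there are no other generators, however, the only edge at v_x is
its null loop, which may not be deleted as v_x would become a sink.  The remedy,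
applied in all cases, is an auxiliary isolated vertex z that stands for the
empty word: a null edge from v_x to z keeps v_x from being a sink, and z is
eliminated after v_x ([graph_equiv_add]). *)

(** * Graphs up to null edges and summation of weights *)

Section Weights.
Context {G : groupType}.
Implicit Types (A B C : wgraph G).

Lemma graph_step_equiv A B : graph_step A B -> graph_equiv A B.
Proof. exact: rst_step. Qed.

Lemma graph_equiv_refl A : graph_equiv A A.
Proof. exact: rst_refl. Qed.

Lemma graph_equiv_sym A B : graph_equiv A B -> graph_equiv B A.
Proof. exact: rst_sym. Qed.

Lemma graph_equiv_trans B A C :
  graph_equiv A B -> graph_equiv B C -> graph_equiv A C.
Proof. exact: rst_trans. Qed.

Definition nonsink (V : eqType) (E : seq (wedge V G)) (v : V) : bool :=
  has (fun e => org e == v) E.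

Definition total (V : eqType) (E : seq (wedge V G)) (p : V * V) : gring G :=
  \sum_(e <- E | (org e, tgt e) == p) wgt e.

Section SameVertices.
Context {V : finType} (l : V -> G).
Implicit Types (E : seq (wedge V G)) (s : seq (V * V)) (W : V * V -> gring G).

Lemma graph_equiv_perm E E' :
  perm_eq E E' -> graph_equiv (WGraph l E) (WGraph l E').
Proof.
move=> EE'; apply/graph_step_equiv/(@graph_iso _ (WGraph l E) (WGraph l E') id).
- by exists id.
- by [].
by rewrite /= map_id_in // => -[[o t] w].
Qed.

Definition wedges W s : seq (wedge V G) := [seq (p.1, p.2, W p) | p <- s].

Lemma add_null_edges E s : all (fun p => nonsink E p.1) s ->
  graph_equiv (WGraph l E) (WGraph l (wedges (fun=> 0) s ++ E)).
Proof.
elim: s => [|p s IH] /=; first by move=> _; apply: graph_equiv_refl.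
case/andP=> Ep /IH; move/graph_equiv_trans; apply.
by apply/graph_step_equiv/graph_null; rewrite has_cat; apply/orP; right.
Qed.

(** Each edge of E is added to the parallel edge of the first list, which holds
exactly one edge for every pair in s. *)
Lemma absorb_edges E W s : uniq s ->
  all (fun e => (org e, tgt e) \in s) E ->
  graph_equiv (WGraph l (wedges W s ++ E))
              (WGraph l (wedges (fun p => W p + total E p) s)).
Proof.
move=> us; elim: E W => [|e E IH] W /=.
  rewrite cats0 => _.
  rewrite [X in graph_equiv _ (WGraph l X)](_ : _ = wedges W s).
    exact: graph_equiv_refl.
  by apply: eq_map => p; rewrite /total big_nil addr0.
case/andP; set p := (org e, tgt e) => ps Es.
(* W' is W after the edge e has been merged into the entry at p. *)
pose W' q := W q + (if p == q then wgt e else 0).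
have sE := perm_to_rem ps.
have eE : e = (p.1, p.2, wgt e) by case: (e) @p {ps W' sE} => -[].
have E1 : perm_eq (wedges W s ++ e :: E)
    ([seq (p.1, p.2, w) | w <- [:: W p; wgt e]] ++ (wedges W (rem p s) ++ E)).
  rewrite /= -eE.
  rewrite (perm_trans (y := wedges W (p :: rem p s) ++ e :: E)) //.
    by rewrite perm_cat2r perm_map.
  by rewrite /= perm_cons perm_sym -cat1s perm_catCA.
have E2 : perm_eq ((p.1, p.2, \sum_(w <- [:: W p; wgt e]) w)
                     :: (wedges W (rem p s) ++ E)) (wedges W' s ++ E).
  rewrite perm_sym.
  rewrite (perm_trans (y := wedges W' (p :: rem p s) ++ E)) //.
    by rewrite perm_cat2r perm_map.
  rewrite /= {1}/W' eqxx !big_cons big_nil addr0 perm_cons perm_cat2r.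
  rewrite (_ : wedges W' _ = wedges W (rem p s)) //.
  apply/eq_in_map => q; rewrite mem_rem_uniq // inE => /andP[/negPf nqp _].
  by rewrite /W' eq_sym nqp addr0.
apply: (graph_equiv_trans (graph_equiv_perm E1)).
apply: graph_equiv_trans (graph_step_equiv (graph_sum _ _ _ _ _)) _ => //.
apply: (graph_equiv_trans (graph_equiv_perm E2)).
rewrite [X in graph_equiv _ (WGraph l X)](_ : _ =
  wedges (fun q => W' q + total E q) s); first exact: IH.
apply: eq_map => q; rewrite /total big_cons /W' -/p.
by case: ifP => _; rewrite ?addr0 ?addrA.
Qed.

(** The normal form under null edges and summation: one edge, possibly null, from
every non-sink to every vertex. *)
Lemma graph_equiv_normal E : graph_equiv (WGraph l E)
  (WGraph l (wedges (total E) (enum [pred p : V * V | nonsink E p.1]))).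
Proof.
set s := enum _.
apply: (@graph_equiv_trans (WGraph l (wedges (fun=> 0) s ++ E))).
  by apply: add_null_edges; apply/allP => p; rewrite mem_enum.
rewrite [X in graph_equiv _ (WGraph l X)](_ : _ =
  wedges (fun p => 0 + total E p) s).
  apply: absorb_edges; first exact: enum_uniq.
  by apply/allP => e eE; rewrite mem_enum /= inE; apply/hasP; exists e.
by apply: eq_map => p; rewrite add0r.
Qed.

Lemma graph_equiv_total E E' :
  nonsink E =1 nonsink E' -> total E =1 total E' ->
  graph_equiv (WGraph l E) (WGraph l E').
Proof.
move=> EE' tE; apply: (graph_equiv_trans (graph_equiv_normal E)).
apply: graph_equiv_sym; apply: (graph_equiv_trans (graph_equiv_normal E')).
have -> : enum [pred p : V * V | nonsink E' p.1] =
          enum [pred p : V * V | nonsink E p.1].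
  by apply: eq_enum => p; rewrite !inE EE'.
set s := enum _; rewrite (_ : wedges (total E') s = wedges (total E) s).
  exact: graph_equiv_refl.
by apply: eq_map => p; rewrite tE.
Qed.

End SameVertices.

Lemma nonsink_emap (V V' : eqType) (f : V -> V') (E : seq (wedge V G)) v :
  injective f -> nonsink [seq emap f e | e <- E] (f v) = nonsink E v.
Proof.
move=> fI; rewrite /nonsink has_map; apply: eq_has => -[[o t] w] /=.
by rewrite /org /= inj_eq.
Qed.

Lemma total_emap (V V' : eqType) (f : V -> V') (E : seq (wedge V G)) o t :
  injective f ->
  total [seq emap f e | e <- E] (f o, f t) = total E (o, t).
Proof.
move=> fI; rewrite /total big_map; apply: eq_bigl => -[[o' t'] w].
by rewrite /org /tgt /= !xpair_eqE !(inj_eq fI).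
Qed.

Lemma graph_equiv_bij A B (f : vert A -> vert B) :
  bijective f -> (forall v, lab (f v) = lab v) ->
  (forall v, nonsink (edges A) v = nonsink (edges B) (f v)) ->
  (forall o t, total (edges A) (o, t) = total (edges B) (f o, f t)) ->
  graph_equiv A B.
Proof.
move=> bf lf nf tf; have [g fK gK] := bf.
apply: (@graph_equiv_trans (WGraph (@lab G B) [seq emap f e | e <- edges A])).
  by apply: graph_step_equiv; apply: (@graph_iso _ _ (WGraph _ _) f).
case: B f bf lf nf tf g fK gK => V l E /= f bf lf nf tf g fK gK.
apply: graph_equiv_total => [v|[o t]].
  by rewrite -[v]gK -nf nonsink_emap //; apply: can_inj fK.
by rewrite -[o]gK -[t]gK -tf total_emap //; apply: can_inj fK.
Qed.

Lemma nonsink_cons (V : eqType) (e : wedge V G) E v :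
  nonsink (e :: E) v = (org e == v) || nonsink E v.
Proof. by []. Qed.

Lemma nonsink_cat (V : eqType) (E E' : seq (wedge V G)) v :
  nonsink (E ++ E') v = nonsink E v || nonsink E' v.
Proof. exact: has_cat. Qed.

Lemma total_cons (V : eqType) (e : wedge V G) E p :
  total (e :: E) p = (if (org e, tgt e) == p then wgt e else 0) + total E p.
Proof. by rewrite /total big_cons; case: ifP; rewrite ?add0r. Qed.

Lemma total_cat (V : eqType) (E E' : seq (wedge V G)) p :
  total (E ++ E') p = total E p + total E' p.
Proof. exact: big_cat. Qed.

(** The edges that a hub resolution puts in place of an edge of weight g from u to v. *)
Lemma total_hub (V : eqType) (E : seq (wedge V G)) u v g o t :
  total [seq (u, tgt e, g * wgt e) | e <- E & org e == v] (o, t) =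
  if u == o then g * total E (v, t) else 0.
Proof.
rewrite /total big_map big_filter_cond mulr_sumr.
case: eqP => [<-|/eqP/negPf uo].
  by apply: eq_bigl => e; rewrite /org /tgt /= !xpair_eqE eqxx.
by rewrite big_pred0 // => e; rewrite xpair_eqE /org /= uo andbF.
Qed.

Lemma nonsink_some (V : eqType) (E : seq (wedge V G)) :
  nonsink [seq emap some e | e <- E] None = false.
Proof. by rewrite /nonsink has_map; elim: E. Qed.

Lemma total_some (V : eqType) (E : seq (wedge V G)) o t :
  (o == None) || (t == None) ->
  total [seq emap some e | e <- E] (o, t) = 0.
Proof.
move=> ot; rewrite /total big_map big_pred0 // => e.
by case: o t ot => [o|] [t|] //=; rewrite xpair_eqE /= andbF.
Qed.

End Weights.

(** * Fox calculus over the group ring of the presented group *)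

Section FoxCalculus.
Context {X : choiceType} {G : groupType} (m : X -> G).
Implicit Types (p q : freegrp X) (w : word X) (x : X).

(** The image in ZG of the free derivative.  It satisfies the product rule with
the factor [prF m p] in place of p, so words that are trivial in G act
trivially; this is what makes the derivatives of relators additive. *)
Definition dfox x p : gring G := prZ m (fox x (gelt p)).

Lemma prF1 : prF m 1%g = 1%g.
Proof. by []. Qed.

Lemma prFV p : prF m (p^-1)%g = ((prF m p)^-1)%g.
Proof.
by rewrite -[LHS]mulg1 -(mulgV (prF m p)) mulgA -prFM mulVg prF1 mul1g.
Qed.

Lemma prZ_gelt p : prZ m (gelt p) = gelt (prF m p).
Proof. exact: glin_gelt. Qed.

Lemma prZ_geltM p (a : gring (freegrp X)) :
  prZ m (gelt p * a) = gelt (prF m p) * prZ m a.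
Proof.
apply: (gring_ext (f := prZ m \o (gelt p \*o idfun))
                  (h := gelt (prF m p) \*o prZ m)) => q /=.
by rewrite -geltM !prZ_gelt prFM geltM.
Qed.

Lemma dfoxM x p q : dfox x (p * q)%g = dfox x p + gelt (prF m p) * dfox x q.
Proof. by rewrite /dfox foxM raddfD /= prZ_geltM. Qed.

Lemma dfox1 x : dfox x 1%g = 0.
Proof. by rewrite /dfox -[1%g]/(fgw [::]) fox_gelt /= raddf0. Qed.

Lemma dfox_gen x y : dfox x (fggen y) = (y == x)%:R.
Proof.
by rewrite /dfox fox_gen; case: eqP => _; rewrite ?raddf0 // -gelt1 prZ_gelt.
Qed.

Lemma geltVK (g : G) a : gelt (g^-1)%g * (gelt g * a) = a.
Proof. by rewrite mulrA -geltM mulVg gelt1 mul1r. Qed.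

Lemma dfoxV x p : dfox x (p^-1)%g = - (gelt ((prF m p)^-1)%g * dfox x p).
Proof.
apply/eqP; rewrite -addr_eq0 addrC -prFV.
by have := dfoxM x (p^-1)%g p; rewrite mulVg dfox1 addrC => <-.
Qed.

Lemma dfoxJ x p q : prF m q = 1%g ->
  dfox x (p * q * p^-1)%g = gelt (prF m p) * dfox x q.
Proof.
move=> q1; rewrite !dfoxM dfoxV prFM q1 mulg1 mulrN mulrA -geltM mulgV gelt1.
by rewrite mul1r addrC addKr.
Qed.

Lemma prF_conj1 p q : prF m (p * q * p^-1)%g = 1%g -> prF m q = 1%g.
Proof.
rewrite !prFM prFV => /(canRL (mulgVK _)); rewrite mul1g => pq.
by apply: (mulgI (prF m p)); rewrite pq mulg1.
Qed.

(** Up to inversion the relator r is conjugate to q = x f^-1 with f its solved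
word.  As q = 1 in G, conjugation multiplies dq by a group element, inversion
changes its sign, and dq = dx - df. *)
Lemma dfox_word (r : bword X) : prF m (fgw (bw_word r)) = 1%g ->
  exists c, forall x, dfox x (fgw (bw_word r)) =
    c * ((bgen r == x)%:R - dfox x (fgw (bw_solve r))).
Proof.
move=> r1; have [c def_r] := bw_solveP r.
pose q : freegrp X := (fggen (bgen r) * (fgw (bw_solve r))^-1)%g.
rewrite -/q in def_r.
have q1 : prF m q = 1%g.
  apply: (@prF_conj1 c); rewrite -def_r.
  by case: ifP => _; rewrite ?prFV r1 ?invg1.
have dq y : dfox y q = (bgen r == y)%:R - dfox y (fgw (bw_solve r)).
  move: q1; rewrite /q prFM prFV => q1.
  by rewrite dfoxM dfoxV dfox_gen mulrN mulrA -geltM q1 gelt1 mul1r.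
have sgn y : dfox y (fgw (bw_word r)) = (-1) ^+ (~~ bsgn r) *
    dfox y (if bsgn r then fgw (bw_word r) else (fgw (bw_word r))^-1)%g.
  case: ifP => _; first by rewrite mul1r.
  by rewrite dfoxV r1 invg1 gelt1 expr1 mul1r mulN1r opprK.
exists ((-1) ^+ (~~ bsgn r) * gelt (prF m c)) => y.
by rewrite sgn def_r dfoxJ // dq mulrA.
Qed.

(** The solved word of r s is that of r with s, or its inverse, inserted between
the parts of r after and before the base point.  Since s = 1 in G, the
derivative of the rest is unaffected by the insertion. *)
Lemma dfox_solve_mul (r s : bword X) : prF m (fgw (bw_word s)) = 1%g ->
  exists c, forall x, dfox x (fgw (bw_solve (bw_mul r s))) =
    dfox x (fgw (bw_solve r)) + c * dfox x (fgw (bw_word s)).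
Proof.
rewrite /bw_solve /=; move: (bw_word s) => w w1; case: (bsgn r); last first.
  exists (gelt (prF m (fgw (bpost r)))) => x.
  rewrite !fgw_cat !dfoxM !prFM w1 mulg1 -!addrA; congr (_ + _).
  by rewrite addrC.
exists (- gelt ((prF m (fgw (bpre r)))^-1)%g) => x.
rewrite !fgw_winv !dfoxV !fgw_cat !dfoxM !prFM w1 mulg1 invgM geltM.
rewrite !mulrDr !opprD -!mulrA geltVK -!addrA mulNr; congr (_ + _).
by rewrite addrC.
Qed.

(** The product rule for a word over any alphabet, with all coefficients already
in ZG: the form in which derivatives over two alphabets can be compared letter
by letter. *)
Lemma dfox_cons x a w :
  dfox x (fgw (a :: w)) = (if a.1 == x then
      (if a.2 then 1 else - gelt (evalw m [:: a])) else 0)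
   + gelt (evalw m [:: a]) * dfox x (fgw w).
Proof.
rewrite -cat1s fgw_cat dfoxM prF_fgw; congr (_ + _).
rewrite /dfox fox_gelt /= mulr0 addr0 /foxl.
case: ifP => _; last by rewrite raddf0.
case: ifP => a2; first by rewrite -gelt1 prZ_gelt.
by rewrite raddfN /= prZ_gelt prF_fgw /= a2.
Qed.

End FoxCalculus.

Section FoxMap.
Context {X Y : choiceType} {G : groupType} (m : X -> G) (n : Y -> G).
Context (f : X -> Y) (mf : forall x, n (f x) = m x).
Implicit Types (w : word X).

Lemma evalw_wmap w : evalw n (wmap f w) = evalw m w.
Proof. by elim: w => //= a w ->; rewrite mf. Qed.

Lemma dfox_wmap x w : injective f ->
  dfox n (f x) (fgw (wmap f w)) = dfox m x (fgw w).
Proof.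
move=> fI; elim: w => [|a w IH]; first by rewrite !dfox1.
by rewrite /= !dfox_cons -/(wmap f w) IH /= (inj_eq fI) !mf.
Qed.

Lemma dfox_wmap0 y w : (forall x, f x != y) ->
  dfox n y (fgw (wmap f w)) = 0.
Proof.
move=> fy; elim: w => [|a w IH]; first by rewrite dfox1.
by rewrite /= dfox_cons -/(wmap f w) IH /= (negPf (fy _)) mulr0 addr0.
Qed.

End FoxMap.

(** * The word solved for the base generator *)

Lemma bw_solve_map (X Y : choiceType) (f : X -> Y) (r : bword X) :
  bw_solve (bw_map f r) = wmap f (bw_solve r).
Proof.
rewrite /bw_solve /= -[wmap f _ ++ _]map_cat; case: ifP => _ //.
by rewrite /winv /wmap map_rev -!map_comp.
Qed.

Section SolvedWord.
Context {X : choiceType}.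
Implicit Types (r s : bword X) (u v w : word X).

Lemma fgw_solve r : fgw (bw_solve r) =
  (let c := fgw (bpost r) * fgw (bpre r) in if bsgn r then c^-1 else c)%g.
Proof. by rewrite /bw_solve; case: bsgn; rewrite ?fgw_winv fgw_cat. Qed.

(** Inversion swaps the two parts of the word around the base point and flips its
sign, and the two effects cancel. *)
Lemma fgw_solve_inv r : fgw (bw_solve (bw_inv r)) = fgw (bw_solve r).
Proof.
rewrite !fgw_solve /= !fgw_winv; case: (bsgn r) => /=; first by rewrite invgM.
by rewrite invgM !invgK.
Qed.

Lemma fgw_solve_conj w r : fgw (bw_solve (bw_conj w r)) = fgw (bw_solve r).
Proof. by rewrite !fgw_solve /= !fgw_cat fgw_winv mulgA mulgVK. Qed.

Lemma fgw_solve_feq r s : bw_feq r s -> fgw (bw_solve s) = fgw (bw_solve r).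
Proof. by case=> upre _ usgn upost; rewrite !fgw_solve upre usgn upost. Qed.

End SolvedWord.

(** * The graph of a presentation *)

Section PresentationGraph.
Context {G : groupType}.
Implicit Types (P Q : bpdata G).

(** The weight pr(df_r / dx) of the edge from the base generator of r to x. *)
Definition slope P (r : rels P) (x : gens P) : gring G :=
  dfox (@mark G P) x (fgw (bw_solve (relator r))).

(** [pgraph] on presentation data, so that one can follow a Tietze operation
without rebuilding the proofs contained in a [bpres]. *)
Definition dgraph P : wgraph G :=
  WGraph (@mark G P)
    [seq (bgen (relator r), x, slope r x)
    | r <- enum (rels P), x <- enum (gens P)].

Lemma total_dgraph P o t :
  total (edges (dgraph P)) (o, t) =
  \sum_(r | bgen (relator r) == o) slope r t.
Proof.
rewrite /total /= big_mkcond big_allpairs_dep /= big_enum /= [RHS]big_mkcond.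
apply: eq_bigr => r _; rewrite big_enum /= -big_mkcond.
rewrite (eq_bigl (fun x => (bgen (relator r) == o) && (x == t))); last first.
  by move=> x; rewrite xpair_eqE.
by case: eqP => _; rewrite ?big_pred0_eq //= big_pred1_eq.
Qed.

Lemma nonsink_dgraph P o :
  nonsink (edges (dgraph P)) o = [exists r : rels P, bgen (relator r) == o].
Proof.
apply/hasP/existsP => [[e /allpairsP[[r x] /= [_ _ ->]] ro]|[r ro]].
  by exists r.
exists (bgen (relator r), bgen (relator r), slope r (bgen (relator r))) => //.
by apply: allpairs_f; rewrite mem_enum.
Qed.

Lemma graph_equiv_same_solve P (i : rels P) (r : bword (gens P)) :
  bgen r = bgen (relator i) -> fgw (bw_solve r) = fgw (bw_solve (relator i)) ->
  graph_equiv (dgraph P) (dgraph (set_relator i r)).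
Proof.
move=> gr sr; rewrite (_ : dgraph (set_relator i r) = dgraph P).
  exact: graph_equiv_refl.
rewrite /dgraph /=; congr WGraph; apply: eq_allpairs => j x.
by rewrite /slope /=; case: eqP => // ->; rewrite gr sr.
Qed.

End PresentationGraph.

(** * Multiplying a relator by another one *)

(** The identity df_i' = df_i + g df_k - g dx_k that matches one hub resolution. *)
Lemma slope_mul (G : groupType) (P : bpdata G) (i k : rels P) :
  prF (@mark G P) (fgw (bw_word (relator k))) = 1%g ->
  exists g, forall x,
    @slope G (set_relator i (bw_mul (relator i) (relator k))) i x =
    slope i x + g * slope k x - (if bgen (relator k) == x then g else 0).
Proof.
move=> k1; have [c dc] := dfox_solve_mul (relator i) k1.
have [d dd] := dfox_word k1.
exists (- (c * d)) => x; rewrite /slope /= eqxx dc dd -addrA; congr (_ + _).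
rewrite mulrA mulrBr addrC mulNr; congr (_ + _).
by case: eqP => _; rewrite ?mulr1 ?opprK ?mulr0 ?oppr0.
Qed.

Lemma graph_equiv_mul (G : groupType) (P : bpdata G) (i k : rels P) :
  injective (fun r : rels P => bgen (relator r)) -> k != i ->
  prF (@mark G P) (fgw (bw_word (relator k))) = 1%g ->
  graph_equiv (dgraph P)
    (dgraph (set_relator i (bw_mul (relator i) (relator k)))).
Proof.
move=> gI ki /(slope_mul i)[g sg]; set P' := set_relator _ _ in sg *.
set xi := bgen (relator i); set xk := bgen (relator k).
have xik : xi != xk by rewrite eq_sym (inj_eq gI).
set E := edges (dgraph P).
have bgE (r : rels P) : bgen (@relator G P' r) = bgen (@relator G P r).
  by rewrite /=; case: eqP => // ->.
have Exi : nonsink E xi by rewrite nonsink_dgraph; apply/existsP; exists i.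
have Exk : nonsink E xk by rewrite nonsink_dgraph; apply/existsP; exists k.
(* 0 = g - g splits off an edge of weight g from xi to xk, which is resolved
   at the hub xk; the edge of weight - g stays. *)
pose E0 := (xi, xk, - g) :: E.
apply: (@graph_equiv_trans _ (WGraph (@mark G P) ((xi, xk, g) :: E0))).
  apply: graph_equiv_total => [v|p].
    rewrite !nonsink_cons /org /=.
    by case: eqP => // <-; rewrite -/E Exi.
  rewrite !total_cons /org /tgt /wgt /=; case: ifP => _.
    by rewrite addNKr.
  by rewrite !add0r.
apply: graph_equiv_trans (graph_step_equiv (graph_hub _ _ xik _)) _.
  by rewrite -[has _ _]/(nonsink E0 xk) nonsink_cons Exk orbT.
apply: graph_equiv_total => [v|[o t]].
  rewrite nonsink_cat nonsink_cons [org (xi, _, _)]/org /=.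
  have -> : nonsink (edges (dgraph P')) v = nonsink E v.
    by rewrite !nonsink_dgraph; apply: eq_existsb => r; rewrite -(bgE r).
  case: (eqVneq xi v) => [<-|xiv].
    by rewrite Exi !orbT.
  rewrite (_ : nonsink _ v = false) //; apply/hasP => -[_ /mapP[e _ ->]].
  by rewrite /org /= (negPf xiv).
have totk : total E (xk, t) = slope k t.
  by rewrite total_dgraph (big_pred1 k) // => r; rewrite (inj_eq gI).
rewrite total_cat total_hub !total_cons /= {1}/org {1}/tgt /=.
rewrite !xpair_eqE eq_sym (negPf xik) add0r totk.
have -> : total (edges (dgraph P')) (o, t) =
    \sum_(r : rels P | bgen (relator r) == o) @slope G P' r t.
  by rewrite total_dgraph; apply: eq_bigl => r; rewrite -(bgE r).
rewrite /E total_dgraph; case: (eqVneq xi o) => [<-|xio] /=; last first.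
  rewrite !add0r; apply: eq_bigr => r /eqP ro; rewrite /slope /=.
  by case: eqP => // ri; rewrite -ro ri eqxx in xio.
rewrite !(big_pred1 i) => [|r|r]; try by rewrite (inj_eq gI).
rewrite sg addrA addrC addrA; congr (_ + _).
by rewrite /wgt /=; case: eqP => _; rewrite ?oppr0.
Qed.

(** * Renaming generators and relators *)

Lemma graph_equiv_relabel (G : groupType) (P Q : bpdata G)
    (f : gens P -> gens Q) (h : rels P -> rels Q) :
  bijective f -> bijective h -> (forall x, mark (f x) = mark x) ->
  (forall r, relator (h r) = bw_map f (relator r)) ->
  graph_equiv (dgraph P) (dgraph Q).
Proof.
move=> bf bh mf rh; have fI := bij_inj bf.
have bgh r : bgen (relator (h r)) = f (bgen (relator r)) by rewrite rh.
apply: (graph_equiv_bij (f := f : vert (dgraph P) -> vert (dgraph Q))) => //.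
  move=> v; rewrite !nonsink_dgraph; have [h' hK h'K] := bh.
  apply/existsP/existsP => -[r rv]; last first.
    by exists (h' r); rewrite -(inj_eq fI) -bgh h'K.
  by exists (h r); rewrite bgh (inj_eq fI).
move=> o t; rewrite !total_dgraph [RHS](reindex h); last exact: onW_bij.
apply: eq_big => r; first by rewrite bgh (inj_eq fI).
by rewrite /slope rh bw_solve_map (dfox_wmap mf).
Qed.

(** * Adding a generator *)

Lemma big_option (A : nmodType) (T : finType) (p : pred (option T))
    (F : option T -> A) :
  \sum_(r | p r) F r =
  (if p None then F None else 0) + \sum_(r | p (Some r)) F (Some r).
Proof.
rewrite big_mkcond -big_enum enumT Finite.enum.unlock /= /option_enum big_cons.
by rewrite big_map -enumT big_enum -big_mkcond.
Qed.

(** An isolated vertex labelled 1 is a source with no outgoing edges that stands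
for the empty word. *)
Lemma graph_equiv_isolated (G : groupType) (V : finType) (l : V -> G)
    (E : seq (wedge V G)) :
  graph_equiv
    (@WGraph G (option V) (fun x => if x is Some v then l v else 1%g)
      [seq emap some e | e <- E])
    (WGraph l E).
Proof.
apply: graph_step_equiv; apply: (@graph_source _ V l E [::] [::]) => v.
by rewrite big_nil; exact: dfox1.
Qed.

Section NewGenerator.
Context {G : groupType} (P : bpdata G) (w : word (gens P)).
Let l := @mark G P.
Let E := edges (dgraph P).
Let N := dgraph (add_generator w).

Lemma slope_add_old (r : rels P) t :
  @slope G (add_generator w) (Some r) t =
  if t is Some x then slope r x else 0.
Proof.
rewrite /slope bw_solve_map; case: t => [x|].
  by rewrite (dfox_wmap (m := l)) //; apply: Some_inj.
by rewrite dfox_wmap0.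
Qed.

Lemma slope_add_new t :
  @slope G (add_generator w) None t =
  if t is Some x then dfox l x (fgw w) else 0.
Proof.
rewrite /slope (_ : bw_solve _ = wmap some w); last first.
  by rewrite /bw_solve /= cats0 /winv /wmap !map_rev revK -!map_comp;
    apply: eq_map => -[x b]; rewrite /= /linv /= negbK.
case: t => [x|].
  by rewrite (dfox_wmap (m := l)) //; apply: Some_inj.
by rewrite dfox_wmap0.
Qed.

Lemma nonsink_add o :
  nonsink (edges N) o = if o is Some x then nonsink E x else true.
Proof.
rewrite nonsink_dgraph; case: o => [x|]; last by apply/existsP; exists None.
rewrite nonsink_dgraph; apply/existsP/existsP => [[[r|] //= rx]|[r rx]].
  by exists r.
by exists (Some r).
Qed.

Lemma total_add o t : total (edges N) (o, t) =
  match o, t with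
  | Some x, Some y => total E (x, y)
  | None, Some y => dfox l y (fgw w)
  | _, None => 0
  end.
Proof.
rewrite total_dgraph big_option /= slope_add_new.
under eq_bigr => r _ do rewrite slope_add_old.
case: o t => [x|] [y|] /=.
- by rewrite add0r total_dgraph.
- by rewrite add0r big1.
- by rewrite big_pred0 ?addr0.
by rewrite big_pred0 ?addr0.
Qed.

(** Both graphs are compared on the vertex set of N with an auxiliary isolated
vertex z: the null edges into the new vertex x, its loop included, are traded
for a null edge from x to z, and then x and z are eliminated one after the
other.  This works also when x is the only generator. *)
Lemma graph_equiv_add : graph_equiv (dgraph P) N.
Proof.
pose l1 x := if x is Some v then l v else 1%g.
pose E1 := [seq emap some e | e <- E].
(* The outgoing edges of x; here None is z, and the null edge to it makes x a
   non-sink even if there are no old generators. *)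
pose ws := (None, 0) :: [seq (Some x, dfox l x (fgw w)) | x <- enum (gens P)].
have wsE v : \sum_(a <- ws | a.1 == v) a.2 =
    if v is Some x then dfox l x (fgw w) else 0.
  rewrite big_cons big_map big_enum_cond /=; case: v => [x|] /=.
    by rewrite (big_pred1 x).
  by rewrite big_pred0 // addr0.
apply/graph_equiv_sym.
apply: graph_equiv_trans; first exact/graph_equiv_sym/graph_equiv_isolated.
apply: graph_equiv_trans (graph_equiv_isolated l E).
apply: graph_equiv_trans (graph_step_equiv
  (@graph_source _ _ l1 E1 ws (wmap some w) _)); last first.
  move=> v; rewrite wsE; case: v => [x|].
    by apply: (dfox_wmap (m := l)) => //; apply: Some_inj.
  by apply: dfox_wmap0.
(* The vertex added last is z on the side of N and x on the other side, so f
   exchanges them. *)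
pose f (x : option (option (gens P))) : option (option (gens P)) :=
  match x with
  | None => Some None | Some None => None | Some (Some v) => Some (Some v)
  end.
have wsN o : nonsink [seq (None, Some a.1, a.2) | a <- ws] o = (o == None).
  apply/hasP/eqP => [[_ /mapP[a _ ->] /eqP <-] //|->].
  by exists (None, Some None, 0); rewrite ?inE ?eqxx.
have wsT o t : total [seq (None, Some a.1, a.2) | a <- ws] (o, t) =
    if (o, t) is (None, Some (Some x)) then dfox l x (fgw w) else 0.
  rewrite /total big_map; case: o => [o|].
    by rewrite big_pred0.
  case: t => [t|]; last by rewrite big_pred0.
  exact: wsE.
refine (@graph_equiv_bij G (@WGraph G (option (vert N)) _
  [seq emap some e | e <- edges N]) (WGraph _ _) f _ _ _ _).
- by exists f => -[[x|]|].
- by case=> [[x|]|] //=; apply: evalw_wmap.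
- case=> [[x|]|]; rewrite [RHS]nonsink_cat wsN.
  + by rewrite !nonsink_emap ?nonsink_add //; apply: Some_inj.
  + by rewrite nonsink_emap ?nonsink_add //; apply: Some_inj.
  + by rewrite nonsink_some nonsink_emap ?nonsink_some //; apply: Some_inj.
move=> o t; rewrite total_cat wsT.
case: o t => [[x|]|] [[y|]|] /=; rewrite ?add0r ?addr0;
  rewrite ?(total_emap _ _ _ (@Some_inj _)) ?total_add ?total_some //;
  by rewrite ?addr0 ?(total_emap _ _ _ (@Some_inj _)) ?total_some.
Qed.

End NewGenerator.

(** * Strong Tietze equivalence *)

Lemma graph_equiv_tietze (G : groupType) (P Q : bpdata G) :
  injective (fun r : rels P => bgen (relator r)) ->
  (forall r : rels P, prF (@mark G P) (fgw (bw_word (relator r))) = 1%g) ->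
  tietze_step P Q -> graph_equiv (dgraph P) (dgraph Q).
Proof.
move=> gI r1 PQ; case: PQ gI r1 => {P Q}.
- by move=> P Q f h bf bh mf rh _ _; apply: graph_equiv_relabel rh.
- move=> P i r ir _ _; apply: graph_equiv_same_solve; last exact: fgw_solve_feq.
  by case: ir.
- by move=> P i _ _; apply: graph_equiv_same_solve; rewrite ?fgw_solve_inv.
- by move=> P i w _ _; apply: graph_equiv_same_solve; rewrite ?fgw_solve_conj.
- by move=> P i k ki gI r1; apply: graph_equiv_mul.
by move=> P w _ _; apply: graph_equiv_add.
Qed.

Theorem theorem1p2 (G : groupType) (P Q : bpres G) :
  strong_tietze P Q -> graph_equiv (pgraph P) (pgraph Q).
Proof.
elim=> [{}P {}Q PQ|{}P|{}P {}Q _|{}P {}Q R _ PQ _ QR].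
- apply: graph_equiv_tietze PQ; first exact: bp_inj.
  by move=> r; apply/(bp_presents P).2/ncl_in; exists r.
- exact: graph_equiv_refl.
- exact: graph_equiv_sym.
exact: graph_equiv_trans PQ QR.
Qed.
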